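(* For $S\subseteq\mathbb R^2$, a point $(\bar x,\bar y)$ belongs to the scalar $\Gamma_J$-convex hull generated using scalar points of $S$ if and only if there are points $(x_i,y_i)\in S$ and probabilities $t_i$ such that $$\bar x=\sum_it_ix_i,\qquad\bar y=\sum_it_iy_i,\qquad\sum_it_ix_iy_i=\bar x\bar y.$$ Equivalently, the random variables $x$ and $y$ (under the probability measure giving mass $t_i$ to $(x_i,y_i)$) have covariance zero. Moreover, this hull satisfies $$\Gamma_J\text{-}\operatorname{co}(S)=\{(x,y)\in\mathbb R^2:(x,y,2xy)\in\operatorname{co}(\Gamma_J(S))\}.$$
   Context: $\Gamma_J(x,y)=(x,y,xy+yx)$, so at level one $\Gamma_J(x,y)=(x,y,2xy)\in\mathbb R^3$; $\operatorname{co}$ is the ordinary convex hull. Families $(x_i,y_i),t_i$ are finite, $t_i\ge0$, $\sum_it_i=1$. A pair $((X,Y),V)$ with $X,Y$ self-adjoint and $V$ an isometry is a $\Gamma_J$-pair if $V^*\Gamma_J(X,Y)V=\Gamma_J(V^*XV,V^*YV)$ coordinatewise. The scalar $\Gamma_J$-convex hull $\Gamma_J\text{-}\operatorname{co}(S)$ generated using scalar points of $S$ is the smallest set $T\subseteq\mathbb R^2$ containing $S$ such that, whenever $(x_1,y_1),\dots,(x_n,y_n)\in T$, $X=\operatorname{diag}(x_i)$, $Y=\operatorname{diag}(y_i)$, $V:\mathbb C\to\mathbb C^n$ is an isometry, and $((X,Y),V)$ is a $\Gamma_J$-pair, one has $(V^*XV,V^*YV)\in T$. *)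

(* Defs.v *)
From HB Require Import structures.
From mathcomp Require Import all_boot all_order all_algebra.
From mathcomp Require Import complex.
From mathcomp Require Import all_classical all_reals all_analysis.

Set Implicit Arguments.
Unset Strict Implicit.
Unset Printing Implicit Defensive.

Import Order.TTheory GRing.Theory Num.Theory.

Local Open Scope classical_set_scope.
Local Open Scope ring_scope.
Local Open Scope sesquilinear_scope.

(* Used both for matrices ([A := 'M_n]) and at level one ([A := R]). *)
Definition GammaJ (A : pzRingType) (x y : A) : A * A * A :=
  (x, y, x * y + y * x).

Section gamma_pairs.
Context {R : realType}.
Local Notation C := R[i].

Definition is_isometry n m (V : 'M[C]_(n, m)) : Prop := V^t* *m V = 1%:M.

Definition compression n m (V : 'M[C]_(n, m)) (X : 'M[C]_n) : 'M[C]_m :=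
  V^t* *m X *m V.

Definition compression3 n m (V : 'M[C]_(n, m)) (Z : 'M[C]_n * 'M[C]_n * 'M[C]_n)
    : 'M[C]_m * 'M[C]_m * 'M[C]_m :=
  (compression V Z.1.1, compression V Z.1.2, compression V Z.2).

Definition GammaJ_pair n m (X Y : 'M[C]_n) (V : 'M[C]_(n, m)) : Prop :=
  [/\ X \is hermsymmx, Y \is hermsymmx, is_isometry V &
      compression3 V (GammaJ X Y) = GammaJ (compression V X) (compression V Y)].

Definition real_diag n (x : 'I_n -> R) : 'M[C]_n :=
  diag_mx (\row_i real_complex R (x i)).

(* V^* X V and V^* Y V are 1 x 1 self-adjoint matrices, i.e. real scalars; the
   point q is the pair of these two scalars. *)
Definition GammaJ_closed (T : set (R * R)) : Prop :=
  forall n (p : 'I_n -> R * R) (V : 'M[C]_(n, 1)) (q : R * R),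
    (forall i, T (p i)) ->
    let X := real_diag (fun i => (p i).1) in
    let Y := real_diag (fun i => (p i).2) in
    GammaJ_pair X Y V ->
    compression V X = (real_complex R q.1)%:M ->
    compression V Y = (real_complex R q.2)%:M ->
    T q.

Definition GammaJ_co (S : set (R * R)) : set (R * R) :=
  smallest GammaJ_closed S.

End gamma_pairs.

Definition convex_hull (R : realType) (M : lmodType R) (A : set M) : set M :=
  smallest (@convex_set R M) A.

(* The mass t i sits at p i (masses of repeated points add up). The hypotheses on
   t are arguments so that the probability instance below can be inferred. *)
Definition atomic_prob d (T : measurableType d) (R : realType) (n : nat)
    (p : 'I_n -> T) (t : 'I_n -> R)
    (t0 : forall i, 0 <= t i) (t1 : \sum_i t i = 1) : set T -> \bar R :=
  fun A => (\sum_i (t i)%:E * \d_(p i) A)%E.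

Lemma atomic_prob_sigma_additive d (T : measurableType d) (R : realType) (n : nat)
    (p : 'I_n -> T) (t : 'I_n -> R)
    (t0 : forall i, 0 <= t i) (t1 : \sum_i t i = 1) :
  semi_sigma_additive (atomic_prob p t0 t1).
Proof.
case: n p t t0 t1 => [|n] p t t0 t1.
  have : 0 = 1 :> R by rewrite -t1 big_ord0.
  by move=> /esym/eqP; rewrite oner_eq0.
pose w k := mscale (NngNum (t0 (inord k)))
  (dirac (p (inord k)) : {measure set T -> \bar R}).
have -> : atomic_prob p t0 t1 = msum w n.+1.
  by apply/funext => A; apply: eq_bigr => i _; rewrite /w /mscale /= inord_val.
exact: measure_semi_sigma_additive.
Qed.

Section atomic_probability.
Context d (T : measurableType d) (R : realType) (n : nat).
Variables (p : 'I_n -> T) (t : 'I_n -> R).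
Hypotheses (t0 : forall i, 0 <= t i) (t1 : \sum_i t i = 1).

Local Notation mu := (atomic_prob p t0 t1).

Let mu0 : mu set0 = 0%E.
Proof. by rewrite /atomic_prob big1 // => i _; rewrite measure0 mule0. Qed.

Let mu_ge0 A : (0 <= mu A)%E.
Proof. by apply: sume_ge0 => i _; rewrite mule_ge0 ?lee_fin. Qed.

Let mu_sigma_additive : semi_sigma_additive mu.
Proof.
exact: atomic_prob_sigma_additive.
Qed.

HB.instance Definition _ := isMeasure.Build _ _ _ mu mu0 mu_ge0 mu_sigma_additive.

Let mu_setT : mu setT = 1%E.
Proof.
rewrite /atomic_prob -[in RHS]t1 -sumEFin.
by apply: eq_bigr => i _; rewrite diracT mule1.
Qed.

HB.instance Definition _ := Measure_isProbability.Build _ _ _ mu mu_setT.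

End atomic_probability.

(* Main.v *)
Require Import Defs.
From mathcomp Require Import all_boot all_order all_algebra.
From mathcomp Require Import complex.
From mathcomp Require Import all_classical all_reals all_analysis.
From mathcomp Require Import measurable_realfun.
From mathcomp Require Import ring lra.

Set Implicit Arguments.
Unset Strict Implicit.
Unset Printing Implicit Defensive.

Import Order.TTheory GRing.Theory Num.Theory.

Local Open Scope classical_set_scope.
Local Open Scope ring_scope.

(** An isometry V from C to C^n is a unit column, and compressing a diagonal
    matrix by it averages the diagonal with the weights t_i = |V_i|^2. Any
    probability vector arises this way (take V_i = sqrt t_i), and a pair of
    real diagonal matrices x, y together with V is a GammaJ-pair exactly when
    the average of x y is the product of the averages of x and of y, because
    diagonal matrices commute and the third coordinate of GammaJ is 2 x y
    ([GammaJ_pair_real_diagP]). So one closure step of the GammaJ-hull is the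
    formation of an average with zero covariance.

    A single step from S already exhausts the hull. Let K be the convex hull of
    GammaJ(S) and E the set of points (x, y) with (x, y, 2xy) in K, that is,
    the points whose image under GammaJ lies in K. A zero-covariance average of
    points of E has as image the average of the images, which is in K since K
    is convex; hence E is closed and contains the GammaJ-hull
    ([GammaJ_closed_graph_in_hull]). Conversely a point of K is a finite
    mixture of points GammaJ(x_i, y_i) with (x_i, y_i) in S, and such a mixture
    has the form (a, b, 2ab) exactly when the weights make x and y
    uncorrelated with means a and b; one closure step then produces (a, b)
    ([GammaJ_co_mixture]). Thus the hull, E, and the set of
    zero-covariance averages of S coincide.

    The reformulation by covariance only needs that an expectation under a
    finitely supported probability is the weighted sum of the values at the
    atoms. *)

(** * Convex hulls as finite mixtures *)

(** Split off the first point: the remaining weights sum to [s = 1 - t 0], and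
    dividing them by [s] gives a mixture of fewer points, which is then joined
    to the first point by one binary convex combination. *)
Lemma convex_set_sum (R : realType) (M : lmodType R) (A : set M) (n : nat)
    (t : 'I_n -> R) (p : 'I_n -> M) :
  convex_set A -> (forall i, 0 <= t i) -> \sum_i t i = 1 ->
  (forall i, A (p i)) -> A (\sum_i t i *: p i).
Proof.
move=> cA; elim: n t p => [|n IHn] t p t0 t1 Ap.
  by move: t1 => /eqP; rewrite big_ord0 eq_sym oner_eq0.
move: t1; rewrite !big_ord_recl; set a := t ord0; set s := \sum_(i < n) _ => t1.
have s0 : 0 <= s by exact: sumr_ge0.
have [s_eq0|s_neq0] := eqVneq s 0.
  (* All the mass is at the first point: [s] cannot be divided by. *)
  have tz i : t (lift ord0 i) = 0.
    by apply: (psumr_eq0P _ s_eq0) => // j _.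
  rewrite big1 => [|i _]; last by rewrite tz scale0r.
  by rewrite addr0; move: t1; rewrite s_eq0 addr0 => ->; rewrite scale1r.
have a1 : a <= 1 by lra.
pose b := \sum_(i < n) (t (lift ord0 i) / s) *: p (lift ord0 i).
have Ab : A b.
  apply: IHn => [i| |i //]; first by rewrite divr_ge0.
  by rewrite -mulr_suml divff.
have -> : \sum_(i < n) t (lift ord0 i) *: p (lift ord0 i) = s *: b.
  rewrite scaler_sumr; apply: eq_bigr => i _.
  by rewrite scalerA mulrCA divff// mulr1.
have /set_mem := cA (p ord0) b (Itv01 (t0 ord0) a1) (mem_set (Ap _)) (mem_set Ab).
by have -> : s = 1 - a by lra.
Qed.

Definition finite_mixtures (R : realType) (M : lmodType R) (A : set M) : set M :=
  [set z | exists (n : nat) (t : 'I_n -> R) (p : 'I_n -> M),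
    [/\ forall i, A (p i), forall i, 0 <= t i, \sum_i t i = 1 &
        z = \sum_i t i *: p i]].

(** Juxtapose the two families, with weights scaled by [k] and [1 - k]. *)
Lemma convex_finite_mixtures (R : realType) (M : lmodType R) (A : set M) :
  convex_set (finite_mixtures A).
Proof.
move=> _ _ k /set_mem[n [t [p [Ap t0 t1 ->]]]] /set_mem[m [u [q [Aq u0 u1 ->]]]].
have k0 : 0 <= k%:num by [].
have k1 : 0 <= 1 - k%:num by rewrite subr_ge0.
have splitl (i : 'I_n) : fintype.split (lshift m i) = inl i :> 'I_n + 'I_m
  by exact: (unsplitK (inl i)).
have splitr (j : 'I_m) : fintype.split (rshift n j) = inr j :> 'I_n + 'I_m
  by exact: (unsplitK (inr j)).
apply/mem_set; exists (n + m)%N.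
exists (fun i : 'I_(n + m) => match fintype.split i with
  inl i => k%:num * t i | inr j => (1 - k%:num) * u j end).
exists (fun i : 'I_(n + m) => match fintype.split i with
  inl i => p i | inr j => q j end).
split => [i|i||].
- by case: fintype.split.
- by case: fintype.split => j; rewrite mulr_ge0.
- rewrite big_split_ord/=.
  under eq_bigr do rewrite splitl.
  under [X in _ + X]eq_bigr do rewrite splitr.
  by rewrite -!mulr_sumr t1 u1; ring.
- rewrite big_split_ord/= -[LHS]/(k%:num *: _ + (1 - k%:num) *: _) !scaler_sumr.
  by congr (_ + _); apply: eq_bigr => i _; rewrite ?splitl ?splitr scalerA.
Qed.

Lemma convex_hullE (R : realType) (M : lmodType R) (A : set M) :
  convex_hull A = finite_mixtures A.
Proof.
apply/seteqP; split.
  apply: smallest_sub; first exact: convex_finite_mixtures.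
  move=> z Az; exists 1%N, (fun=> 1), (fun=> z).
  by split => //; rewrite big_ord1 ?scale1r.
move=> z [n [t [p [Ap t0 t1 ->]]]] B [cB AB].
by apply: convex_set_sum => // i; exact: AB.
Qed.

Lemma convex_hull_convex (R : realType) (M : lmodType R) (A : set M) :
  convex_set (convex_hull A).
Proof. by rewrite convex_hullE; exact: convex_finite_mixtures. Qed.

(** * Convex combinations of points of the graph of GammaJ *)

Lemma sum_GammaJ (R : realType) (n : nat) (t x y : 'I_n -> R) :
  \sum_i t i *: (GammaJ (x i) (y i) : R * R * R) =
  (\sum_i t i * x i, \sum_i t i * y i, 2 * \sum_i t i * (x i * y i)).
Proof.
rewrite mulr_sumr; elim: (index_enum _) => [|i s IHs]; rewrite ?big_nil//.
rewrite !big_cons IHs; congr (_, _, _); rewrite /=; congr (_ + _).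
by rewrite -[_ *: _]/(_ * _); ring.
Qed.

Lemma GammaJ_scalarE (R : realType) (x y : R) : GammaJ x y = (x, y, 2 * x * y).
Proof. by rewrite /GammaJ; congr (_, _, _); ring. Qed.

(** Since the third coordinate of GammaJ is twice the product, asking that a
    mixture of points GammaJ(x_i, y_i) be of the form (a, b, 2ab) is asking
    that the covariance of x and y vanish. *)
Lemma hull_graph_mixtureP (R : realType) (S : set (R * R)) (a b : R) :
  convex_hull [set GammaJ q.1 q.2 | q in S] (a, b, 2 * a * b) <->
  exists (n : nat) (x y t : 'I_n -> R),
    [/\ forall i, S (x i, y i), forall i, 0 <= t i & \sum_i t i = 1] /\
    [/\ a = \sum_i t i * x i, b = \sum_i t i * y i &
        \sum_i t i * (x i * y i) = a * b].
Proof.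
rewrite convex_hullE; split.
  move=> [n [t [p [Sp t0 t1]]]].
  have /choice[q Sq] : forall i, exists r : R * R, S r /\ GammaJ r.1 r.2 = p i.
    by move=> i; have [r Sr <-] := Sp i; exists r.
  under eq_bigr do rewrite -(Sq _).2.
  rewrite sum_GammaJ => -[aE bE abE].
  exists n, (fun i => (q i).1), (fun i => (q i).2), t; split; split => //.
    by move=> i; have [] := Sq i; case: (q i).
  by lra.
move=> [n [x [y [t [[Sxy t0 t1] [aE bE abE]]]]]].
exists n, t, (fun i => GammaJ (x i) (y i)); split => //.
  by move=> i; exists (x i, y i).
by rewrite sum_GammaJ abE -aE -bE mulrA.
Qed.

(** * Compressions of diagonal matrices to a line *)

Definition column_weight (R : realType) (n : nat) (V : 'M[R[i]]_(n, 1))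
    (i : 'I_n) : R :=
  complex.Re (V i 0) ^+ 2 + complex.Im (V i 0) ^+ 2.

Lemma column_weight_ge0 (R : realType) (n : nat) (V : 'M[R[i]]_(n, 1))
    (i : 'I_n) :
  0 <= column_weight V i.
Proof. by rewrite addr_ge0 ?sqr_ge0. Qed.

Lemma compression_real_diag (R : realType) (n : nat) (V : 'M[R[i]]_(n, 1))
    (x : 'I_n -> R) :
  compression V (real_diag x) =
    (real_complex R (\sum_i column_weight V i * x i))%:M.
Proof.
apply/matrixP => i j; rewrite !ord1 /compression /real_diag mul_mx_diag !mxE.
rewrite mulr1n rmorph_sum/=; apply: eq_bigr => k _.
by rewrite !mxE rmorphM/= add_Re2_Im2 normCK; ring.
Qed.

(** The isometry equation is the compression of the identity matrix. *)
Lemma isometry_column (R : realType) (n : nat) (V : 'M[R[i]]_(n, 1)) :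
  is_isometry V <-> \sum_i column_weight V i = 1.
Proof.
have -> : is_isometry V <-> compression V (real_diag (fun=> 1)) = 1%:M.
  rewrite /compression /real_diag.
  by rewrite (_ : diag_mx _ = 1%:M) ?mulmx1//; apply/matrixP => i j; rewrite !mxE.
rewrite compression_real_diag; under eq_bigr do rewrite mulr1.
split => [/matrixP/(_ 0 0)|->]; last by rewrite rmorph1.
by rewrite !mxE !mulr1n -(rmorph1 (real_complex R)) => /complexI.
Qed.

Lemma real_diag_hermitian (R : realType) (n : nat) (x : 'I_n -> R) :
  real_diag x \is hermsymmx.
Proof.
apply/is_hermitianmxP; rewrite expr0 scale1r; apply/matrixP => i j; rewrite !mxE.
rewrite rmorphMn/= [_ == _ in RHS]eq_sym.
have [->|//] := eqVneq i j; rewrite mulr1n.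
exact/esym/conjc_real.
Qed.

Lemma GammaJ_real_diag (R : realType) (n : nat) (x y : 'I_n -> R) :
  GammaJ (real_diag x) (real_diag y) =
  (real_diag x, real_diag y, real_diag (fun i => 2 * (x i * y i))).
Proof.
congr (_, _, _); rewrite -[real_diag x * real_diag y]/(_ *m _)
  -[real_diag y * real_diag x]/(_ *m _) !mulmx_diag -raddfD/=.
congr diag_mx; apply/rowP => i; rewrite !mxE -!rmorphM/= -rmorphD/=.
by congr (_%:C)%C; ring.
Qed.

(** Only the third coordinate of the GammaJ-pair equation has content; there
    both sides carry the factor 2 of xy + yx, which cancels. *)
Lemma GammaJ_pair_real_diagP (R : realType) (n : nat) (x y : 'I_n -> R)
    (V : 'M[R[i]]_(n, 1)) (t := column_weight V) :
  GammaJ_pair (real_diag x) (real_diag y) V <->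
  \sum_i t i = 1 /\
  \sum_i t i * (x i * y i) = (\sum_i t i * x i) * (\sum_i t i * y i).
Proof.
set a := \sum_i t i * x i; set b := \sum_i t i * y i.
have coordE : compression3 V (GammaJ (real_diag x) (real_diag y)) =
    GammaJ (compression V (real_diag x)) (compression V (real_diag y)) <->
    \sum_i t i * (x i * y i) = a * b.
  rewrite GammaJ_real_diag /compression3/= !compression_real_diag -/t -/a -/b.
  have -> : \sum_i t i * (2 * (x i * y i)) = 2 * \sum_i t i * (x i * y i).
    by rewrite mulr_sumr; apply: eq_bigr => i _; ring.
  have mulE u v : u%:M * v%:M = (u * v)%:M :> 'M[R[i]]_1 by rewrite scalar_mxM.
  rewrite /GammaJ !mulE -raddfD/= -!rmorphM -rmorphD/=.
  split => [[/matrixP/(_ 0 0)]|->]; last by congr (_, _, (_%:C)%C%:M); ring.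
  by rewrite !mxE !mulr1n => /complexI; lra.
split.
  by move=> [_ _ /isometry_column t1 /coordE].
move=> [t1 /coordE ?]; split => //; try exact: real_diag_hermitian.
exact/isometry_column.
Qed.

Lemma column_of_weights (R : realType) (n : nat) (t : 'I_n -> R) :
  (forall i, 0 <= t i) ->
  column_weight (\col_i real_complex R (Num.sqrt (t i))) = t.
Proof.
move=> t0; apply/funext => i.
by rewrite /column_weight !mxE/= expr0n addr0 sqr_sqrtr.
Qed.

(** * The GammaJ-hull *)

(** GammaJ maps a zero-covariance average of points to the average of their
    images, which stays in the convex hull by convexity. *)
Lemma GammaJ_closed_graph_in_hull (R : realType) (S : set (R * R)) :
  GammaJ_closed
    [set p | convex_hull [set GammaJ q.1 q.2 | q in S]
               (p.1, p.2, 2 * p.1 * p.2)].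
Proof.
move=> n p V q Kp X Y /GammaJ_pair_real_diagP[t1 cov0].
rewrite !compression_real_diag => /matrixP/(_ 0 0) q1 /matrixP/(_ 0 0) q2.
move: q1 q2; rewrite !mxE !mulr1n => /complexI q1 /complexI q2.
have q12 : \sum_i column_weight V i * ((p i).1 * (p i).2) = q.1 * q.2.
  by rewrite cov0 q1 q2.
rewrite /mkset -mulrA -q12 -q1 -q2 -sum_GammaJ.
apply: convex_set_sum => //; first exact: convex_hull_convex.
- exact: column_weight_ge0.
- by move=> i; rewrite GammaJ_scalarE; exact: Kp.
Qed.

(** The column of the square roots of the weights realises the average in a
    single closure step. *)
Lemma GammaJ_co_mixture (R : realType) (S : set (R * R)) (n : nat)
    (x y t : 'I_n -> R) :
  (forall i, S (x i, y i)) -> (forall i, 0 <= t i) -> \sum_i t i = 1 ->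
  \sum_i t i * (x i * y i) = (\sum_i t i * x i) * (\sum_i t i * y i) ->
  GammaJ_co S (\sum_i t i * x i, \sum_i t i * y i).
Proof.
move=> Sxy t0 t1 cov0 T [clT ST].
pose V : 'M[R[i]]_(n, 1) := \col_i real_complex R (Num.sqrt (t i)).
have VE : column_weight V = t by exact: column_of_weights.
apply: (clT n (fun i => (x i, y i)) V) => [i| | |] /=.
- exact: ST.
- by apply/GammaJ_pair_real_diagP; rewrite VE.
- by rewrite compression_real_diag VE.
- by rewrite compression_real_diag VE.
Qed.

Lemma GammaJ_coE (R : realType) (S : set (R * R)) :
  GammaJ_co S =
    [set p : R * R | convex_hull [set GammaJ q.1 q.2 | q in S]
                       (p.1, p.2, 2 * p.1 * p.2)].
Proof.
apply/seteqP; split.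
  apply: smallest_sub; first exact: GammaJ_closed_graph_in_hull.
  move=> q Sq; rewrite /mkset -GammaJ_scalarE.
  by apply: sub_gen_smallest; exists q.
move=> [a b] /hull_graph_mixtureP /= [n [x [y [t [[Sxy t0 t1] [aE bE ab]]]]]].
by rewrite aE bE; apply: GammaJ_co_mixture => //; rewrite -aE -bE.
Qed.

(** * Covariance under a finitely supported probability *)

(** For nonnegative integrands, integrals are additive in the measure, so the
    measure is written as a sum of scaled Dirac masses. *)
Lemma ge0_integral_atomic_prob d (T : measurableType d) (R : realType) (n : nat)
    (p : 'I_n -> T) (t : 'I_n -> R) (t0 : forall i, 0 <= t i)
    (t1 : \sum_i t i = 1) (f : T -> \bar R) :
  measurable_fun [set: T] f -> (forall x, 0 <= f x)%E ->
  (\int[atomic_prob p t0 t1]_x f x = \sum_i (t i)%:E * f (p i))%E.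
Proof.
case: n p t t0 t1 => [|n] p t t0 t1 mf f0.
  by have /eqP := t1; rewrite big_ord0 eq_sym oner_eq0.
(* Sums of measures are indexed by all naturals: indices beyond [n] are sent by
   [inord] to some atom, and do not enter the sum. *)
pose w k := mscale (NngNum (t0 (inord k)))
  (dirac (p (inord k)) : {measure set T -> \bar R}).
have muE : atomic_prob p t0 t1 = msum w n.+1 :> (set T -> \bar R).
  by apply/funext => A; apply: eq_bigr => i _; rewrite /w /mscale/= inord_val.
rewrite (eq_measure_integral (msum w n.+1)) => [|A _ _];
  last exact: (congr1 (@^~ A) muE).
rewrite ge0_integral_measure_sum//; apply: eq_bigr => i _.
rewrite ge0_integral_mscale//= integral_dirac//.
by rewrite diracT mul1e inord_val.
Qed.

(** The weighted sum is finite, so the formula for nonnegative integrands can be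
    applied to the positive and negative parts and the results subtracted. *)
Lemma expectation_atomic_prob d (T : measurableType d) (R : realType) (n : nat)
    (p : 'I_n -> T) (t : 'I_n -> R) (t0 : forall i, 0 <= t i)
    (t1 : \sum_i t i = 1) (f : T -> R) :
  measurable_fun [set: T] f ->
  expectation (atomic_prob p t0 t1) f = (\sum_i t i * f (p i))%:E.
Proof.
move=> mf; have mF : measurable_fun setT (EFin \o f) by exact/measurable_EFinP.
rewrite unlock integralE !ge0_integral_atomic_prob//; last 2 first.
- exact: measurable_funeneg.
- exact: measurable_funepos.
have fin g : (\sum_i (t i)%:E * (g (p i))%:E = (\sum_i t i * g (p i))%:E)%E.
  by rewrite -sumEFin.
rewrite funerpos funerneg (fin f^\+) (fin f^\-) -EFinB -sumrB; congr EFin.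
by apply: eq_bigr => i _; rewrite -mulrBr -[in RHS](funrposBneg f).
Qed.

Lemma covariance_atomic_prob d (T : measurableType d) (R : realType) (n : nat)
    (p : 'I_n -> T) (t : 'I_n -> R) (t0 : forall i, 0 <= t i)
    (t1 : \sum_i t i = 1) (f g : T -> R) :
  measurable_fun [set: T] f -> measurable_fun [set: T] g ->
  covariance (atomic_prob p t0 t1) f g =
  (\sum_i t i * (f (p i) * g (p i))
    - (\sum_i t i * f (p i)) * (\sum_i t i * g (p i)))%:E.
Proof.
move=> mf mg; rewrite unlock !expectation_atomic_prob//=; last first.
  by apply: measurable_funM; exact: measurable_funB.
set a := \sum_i t i * f _; set b := \sum_i t i * g _; congr EFin.
have -> : \sum_i t i * ((f \- cst a) * (g \- cst b)) (p i) =
    \sum_i (t i * (f (p i) * g (p i)) - b * (t i * f (p i))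
            - a * (t i * g (p i)) + a * b * t i).
  by apply: eq_bigr => i _; rewrite !fctE/=; ring.
by rewrite big_split/= !sumrB -!mulr_sumr t1 -/a -/b; ring.
Qed.

Theorem proposition9p3 (R : realType) (S : set (R * R)) :
  [/\ (forall xbar ybar : R,
        GammaJ_co S (xbar, ybar) <->
        exists (n : nat) (x y t : 'I_n -> R),
          [/\ forall i, S (x i, y i), forall i, 0 <= t i & \sum_i t i = 1] /\
          [/\ xbar = \sum_i t i * x i,
              ybar = \sum_i t i * y i &
              \sum_i t i * (x i * y i) = xbar * ybar]),
      (forall (n : nat) (x y t : 'I_n -> R)
          (t0 : forall i, 0 <= t i) (t1 : \sum_i t i = 1) (xbar ybar : R),
        (forall i, S (x i, y i)) ->
        xbar = \sum_i t i * x i ->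
        ybar = \sum_i t i * y i ->
        \sum_i t i * (x i * y i) = xbar * ybar <->
        covariance (atomic_prob (fun i => (x i, y i)) t0 t1) fst snd = 0%E) &
      GammaJ_co S =
        [set p : R * R | convex_hull [set GammaJ q.1 q.2 | q in S]
                           (p.1, p.2, 2 * p.1 * p.2)]].
Proof.
split.
- by move=> a b; rewrite GammaJ_coE; exact: hull_graph_mixtureP.
- move=> n x y t t0 t1 a b _ aE bE.
  rewrite covariance_atomic_prob; [|exact: measurable_fst|exact: measurable_snd].
  rewrite /= -aE -bE; split => [->|]; first by rewrite subrr.
  by move=> [] /eqP; rewrite subr_eq0 => /eqP.
- exact: GammaJ_coE.
Qed.
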